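(* Let $X$ be an infinite set of cardinality $\kappa$ and let $\lambda\leq 2^\kappa$ be a cardinal. Then there is a monoidal interval in the clone lattice over $X$ isomorphic to $1+\mathcal{P}(\lambda)$, the power set of $\lambda$ (ordered by inclusion) with a new smallest element added.
   Context: For $n\ge 1$, $\mathcal{O}^{(n)}$ is the set of all $n$-ary operations $X^n\to X$, and $\mathcal{O}=\bigcup_{n\geq 1}\mathcal{O}^{(n)}$. A clone on $X$ is a set $\mathcal{C}\subseteq\mathcal{O}$ closed under composition and containing all projections $\pi^n_k(x_1,\ldots,x_n)=x_k$ ($1\le k\le n$). The clone lattice $Cl(X)$ is the set of all clones on $X$ ordered by inclusion. For a submonoid $\mathcal{G}$ of $\mathcal{O}^{(1)}$ (under composition, containing the identity), the monoidal interval $\mathcal{I}_{\mathcal{G}}$ is the set of all clones $\mathcal{C}$ on $X$ with $\mathcal{C}\cap\mathcal{O}^{(1)}=\mathcal{G}$, ordered by inclusion. A monoidal interval is an interval of the form $\mathcal{I}_{\mathcal{G}}$. *)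

(* Defs.v *)
From mathcomp Require Import all_boot.
From mathcomp Require Import all_classical.

Set Implicit Arguments.
Unset Strict Implicit.
Unset Printing Implicit Defensive.

Local Open Scope classical_set_scope.

Definition op (X : Type) (n : nat) : Type := ('I_n -> X) -> X.

(* The union of all op X n for n >= 1: nullary operations are excluded, so the
   tag n stands for the arity n.+1. *)
Definition operation (X : Type) : Type := {n : nat & op X n.+1}.

Definition Operation (X : Type) (n : nat) (f : op X n.+1) : operation X :=
  existT (fun k => op X k.+1) n f.

Definition proj (X : Type) (n : nat) (k : 'I_n) : op X n := fun x => x k.

Definition compose (X : Type) (n m : nat) (f : op X n) (g : 'I_n -> op X m) :
  op X m := fun x => f (fun i => g i x).

Definition is_clone (X : Type) (C : set (operation X)) : Prop :=
  (forall (n : nat) (k : 'I_n.+1), C (Operation (@proj X n.+1 k))) /\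
  (forall (n m : nat) (f : op X n.+1) (g : 'I_n.+1 -> op X m.+1),
     C (Operation f) -> (forall i, C (Operation (g i))) ->
     C (Operation (compose f g))).

Definition is_unary_submonoid (X : Type) (G : set (op X 1)) : Prop :=
  G (proj ord0) /\
  (forall f g : op X 1, G f -> G g -> G (compose f (fun _ => g))).

Definition unary_part (X : Type) (C : set (operation X)) : set (op X 1) :=
  [set f | C (Operation f)].

Definition monoidal_interval (X : Type) (G : set (op X 1)) :
  set (set (operation X)) :=
  [set C | is_clone C /\ unary_part C = G].

Definition is_monoidal_interval (X : Type) (I : set (set (operation X))) :
  Prop :=
  exists G : set (op X 1), is_unary_submonoid G /\ I = monoidal_interval G.

(* The order of 1 + P, where P is ordered by le and None is the new smallest
   element. *)
Definition le_add_bottom (P : Type) (le : P -> P -> Prop) (a b : option P) :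
  Prop :=
  match a, b with
  | None, _ => True
  | Some _, None => False
  | Some x, Some y => le x y
  end.

Definition order_isomorphic (S T : Type) (A : set S) (leS : S -> S -> Prop)
  (B : set T) (leT : T -> T -> Prop) : Prop :=
  exists f : S -> T, set_bij A B f /\
    (forall x y, A x -> A y -> (leS x y <-> leT (f x) (f y))).

(* Main.v *)
Require Import Defs.
From mathcomp Require Import all_boot.
From mathcomp Require Import all_classical.

Set Implicit Arguments.
Unset Strict Implicit.
Unset Printing Implicit Defensive.

Local Open Scope classical_set_scope.
Local Open Scope card_scope.

(** Split [X], up to a bijection, into cells and outside points: a cell has a row
    in [nat] and a column in [option nat]; an outside point is either an element
    of [option nat] or an element of [X]. As [L] embeds in the power set of [X],
    every [a : L] is coded by a set [S a] of outside points. Write [collapse] for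
    the retraction of [option nat] that sends [None] to [Some 0], and define a
    family of labels from [X] to [option nat], indexed by [option L], that are
    [Some 0] on all cells: [label (Some a)] is the identity on the outside points
    from [option nat] and tells whether an outside point from [X] lies in [S a],
    by the values [None] and [Some 0]; [label None] is the common collapse of
    all the others.

    The monoid consists of the identity, the constants, the map [retract]
    collapsing the column of a cell, and the maps into cells whose row is
    constant or the row of the argument and whose column is constant or some
    label of the argument. The key operations are the binary
    [basic k : (x, y) |-> cell (row x) (label k y)]. Any two of them compose
    trivially, because labels do not see cells, and so they generate nothing from
    one another; the one exception is that [retract] turns every [basic k] into
    [basic None]. Substituting for both variables of [basic k] maps of the monoid
    in a single variable gives a map of the monoid.

    An operation preserving the monoid has all its unary sections in the monoid,
    since the constants are there. The monoid is poor enough for this to force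
    the row and the column of the operation to depend on one variable each
    ([rigid]), and a case analysis shows that the operation is a projection, a
    constant, [retract] of one variable, or [cell (row x_i) (label k x_j)] with
    either part possibly replaced by a constant ([classify]). Therefore a clone of
    the interval is determined by the set [P] of all [k : option L] such that it
    contains [basic k] ([clone_eq_form_clone]), and every [P] occurs that contains
    [None] as soon as it is nonempty ([form_clone_is_clone],
    [basics_form_clone]). These [P] are the empty set, which is the new smallest
    element, and the sets made of [None] and of an arbitrary subset of [L]. *)

(** * Changing one entry of a tuple *)

Section Update.
Variables (n : nat) (X : Type).

Definition update (x : 'I_n -> X) (i : 'I_n) (v : X) : 'I_n -> X :=
  fun j => if j == i then v else x j.

Lemma update_self x i : update x i (x i) = x.
Proof. by apply/funext => j; rewrite /update; case: eqP => // ->. Qed.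

Lemma update_idem x i v w : update (update x i v) i w = update x i w.
Proof. by apply/funext => j; rewrite /update; case: eqP. Qed.

Lemma update_swap x i j v w : i != j ->
  update (update x i v) j w = update (update x j w) i v.
Proof.
move=> ij; apply/funext => l; rewrite /update.
by case: (eqVneq l j) => // ->; rewrite eq_sym (negbTE ij).
Qed.

Lemma update_ind (P : ('I_n -> X) -> Prop) (a : 'I_n -> X) :
  P a -> (forall x j v, P x -> P (update x j v)) -> forall b, P b.
Proof.
move=> Pa Pupd b.
have foldE s l : foldr (fun j x => update x j (b j)) a s l =
    if l \in s then b l else a l.
  elim: s => //= j s IHs; rewrite /update IHs inE.
  by case: eqVneq => // ->.
have -> : b = foldr (fun j x => update x j (b j)) a (enum 'I_n).
  by apply/funext => l; rewrite foldE mem_enum.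
by elim: (enum 'I_n) => //= j s; apply: Pupd.
Qed.

End Update.

(** * Functions all of whose unary sections are constant or special *)

Section Rigidity.
(* In the application the maps of [U] take more than two values at some points,
   but only two up to the identifications made by [r]. *)
Variables (X V R : Type) (r : V -> R) (alpha beta : X -> R).
Variable U : set (X -> V).
Hypothesis U_two_values :
  forall u x, U u -> r (u x) = alpha x \/ r (u x) = beta x.
Hypothesis U_many_values : forall u, U u ->
  forall a b c, exists x, [/\ r (u x) <> a, r (u x) <> b & r (u x) <> c].

Definition constant_or_in (s : X -> V) : Prop :=
  U s \/ forall z z', s z = s z'.

(** A nonconstant row [u] meets more than two [r]-values, whereas at the height
    [y0] of that row a nonconstant column can only meet two: so some column is
    constant. If another column were nonconstant, the rows joining the two
    columns would be nonconstant for too many values. *)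
Lemma rigid_binary (k : X -> X -> V) (y0 : X) :
  (forall y, constant_or_in (fun x => k x y)) ->
  (forall x, constant_or_in (k x)) ->
  U (fun x => k x y0) -> forall x y y', k x y = k x y'.
Proof.
move=> rows cols Uy0 x.
have [x0 [x0a x0b _]] := U_many_values Uy0 (alpha y0) (beta y0) (beta y0).
have const_x0 : forall y y', k x0 y = k x0 y'.
  by case: (cols x0) => // /(U_two_values y0)[].
case: (cols x) => // Ux.
have [y [yc ya yb]] := U_many_values Ux (r (k x0 y0)) (alpha x) (beta x).
case: (rows y) => [/(U_two_values x)[]//|const_y].
by case: yc; rewrite (const_y x x0) (const_x0 y y0).
Qed.

(** By the binary case, a section in [U] along coordinate [i] is unaffected by
    changing any other coordinate, hence is the same at every tuple. *)
Lemma rigid (n : nat) (K : ('I_n -> X) -> V) (p : X) :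
  (forall i x, constant_or_in (fun z => K (update x i z))) ->
  (exists c, forall x, K x = c) \/
  (exists i u, U u /\ forall x, K x = u (x i)).
Proof.
move=> sec.
have [[i [a Ua]]|noU] :=
  pselect (exists i a, U (fun z => K (update a i z))); last first.
  left; exists (K (fun=> p)).
  apply: (@update_ind _ _ _ (fun=> p)) => // x j v <-.
  case: (sec j x) => [Ux|c]; first by case: noU; exists j, x.
  by rewrite (c v (x j)) update_self.
right; exists i, (fun z => K (update a i z)); split=> // x.
suff /(f_equal (fun s => s (x i))) : (fun z => K (update x i z)) =
    (fun z => K (update a i z)) by rewrite /= update_self.
apply: (update_ind (P := fun x => (fun z => K (update x i z)) =
  (fun z => K (update a i z))) (a := a)) => // {}x j v IHx.
rewrite -IHx; apply/funext => z.
case: (eqVneq j i) => [->|ji]; first by rewrite update_idem.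
rewrite -[in RHS](update_self x j).
apply: (@rigid_binary (fun z v => K (update (update x j v) i z)) (x j)).
- by move=> y; exact: sec.
- move=> y; rewrite (_ : (fun v => _) = fun v => K (update (update x i y) j v)).
    exact: sec.
  by apply/funext => w; rewrite update_swap.
- by rewrite update_self IHx.
Qed.

End Rigidity.

(** * The clones of the interval *)

Section Construction.
Variables (X L : Type).
Let Z : Type := ((nat * option nat) + (option nat + X))%type.
Variables (phi : X -> Z) (psi : Z -> X).
Hypotheses (phiK : cancel phi psi) (psiK : cancel psi phi).
Variable S : L -> set X.
Hypothesis S_inj : injective S.

(** The value [None] is a second copy of [Some 0]: telling them apart is what
    codes the sets [S a], and [collapse] forgets the difference. *)
Definition collapse (w : option nat) : option nat := Some (odflt 0 w).

Definition cell (t : nat) (w : option nat) : X := psi (inl (t, w)).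

Definition row (x : X) : nat := if phi x is inl (t, _) then t else 0.

Definition col (x : X) : option nat :=
  if phi x is inl (_, w) then collapse w else Some 0.

(** The outside points from [option nat] give every label infinitely many
    values, as needed for rigidity, and make [label None] differ from
    [label (Some a)] even when [S a] is empty. *)
Definition label (k : option L) (x : X) : option nat :=
  match phi x with
  | inl _ => Some 0
  | inr (inl w) => if k is Some _ then w else collapse w
  | inr (inr x') =>
      if k is Some a then (if `[< S a x' >] then None else Some 0) else Some 0
  end.

Definition retract (x : X) : X := cell (row x) (col x).

(** Syntax for the operations that preserve the monoid; composition is carried
    out on this syntax. *)
Inductive row_term (n : nat) := RowConst of nat | RowOf of 'I_n.
Inductive col_term (n : nat) :=
  ColConst of option nat | LabelOf of option L & 'I_n.
Inductive form (n : nat) :=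
  | FProj of 'I_n
  | FConst of X
  | FRetract of 'I_n
  | FCell of row_term n & col_term n.

Arguments RowConst {n}. Arguments ColConst {n}. Arguments FConst {n}.

Definition row_eval n (t : row_term n) (x : 'I_n -> X) : nat :=
  match t with RowConst t => t | RowOf i => row (x i) end.

Definition col_eval n (w : col_term n) (x : 'I_n -> X) : option nat :=
  match w with ColConst w => w | LabelOf k j => label k (x j) end.

Definition eval n (F : form n) : op X n := fun x =>
  match F with
  | FProj i => x i
  | FConst c => c
  | FRetract i => retract (x i)
  | FCell t w => cell (row_eval t x) (col_eval w x)
  end.

(** A cell whose row and label come from two different variables yields
    [basic k] by identifying variables; every other form is a unary operation
    applied to one variable. *)
Definition allowed n (P : set (option L)) (F : form n) : Prop :=
  if F is FCell (RowOf i) (LabelOf k j) then i = j \/ P k else True.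

Definition form_clone (P : set (option L)) : set (operation X) :=
  fun f => exists F : form (projT1 f).+1, allowed P F /\ projT2 f = eval F.

Lemma form_cloneP P n (f : op X n.+1) :
  form_clone P (Operation f) <-> exists F, allowed P F /\ f = eval F.
Proof. by []. Qed.

Lemma collapse_col x : collapse (col x) = col x.
Proof. by rewrite /col; case: (phi x) => [[]|]. Qed.

Lemma row_cell t w : row (cell t w) = t.
Proof. by rewrite /row /cell psiK. Qed.

Lemma col_cell t w : col (cell t w) = collapse w.
Proof. by rewrite /col /cell psiK. Qed.

Lemma label_cell k t w : label k (cell t w) = Some 0.
Proof. by rewrite /label /cell psiK. Qed.

Lemma collapse_label k x : collapse (label k x) = label None x.
Proof.
rewrite /label; case: (phi x) => // -[w|x']; first by case: k.
by case: k => // a; case: ifP.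
Qed.

Definition row_subst n m (t : row_term n) (G : 'I_n -> form m) : row_term m :=
  match t with
  | RowConst t => RowConst t
  | RowOf i => match G i with
              | FProj j => RowOf j
              | FConst c => RowConst (row c)
              | FRetract j => RowOf j
              | FCell t _ => t
              end
  end.

Definition col_subst n m (w : col_term n) (G : 'I_n -> form m) : col_term m :=
  match w with
  | ColConst w => ColConst w
  | LabelOf k i => match G i with
              | FProj j => LabelOf k j
              | FConst c => ColConst (label k c)
              | _ => ColConst (Some 0)
              end
  end.

Definition col_collapse n (w : col_term n) : col_term n :=
  match w with
  | ColConst w => ColConst (collapse w)
  | LabelOf _ j => LabelOf None j
  end.

Definition subst n m (F : form n) (G : 'I_n -> form m) : form m :=
  match F with
  | FProj i => G i
  | FConst c => FConst c
  | FRetract i => match G i with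
              | FProj j => FRetract j
              | FConst c => FConst (retract c)
              | FRetract j => FRetract j
              | FCell t w => FCell t (col_collapse w)
              end
  | FCell t w => FCell (row_subst t G) (col_subst w G)
  end.

Lemma eval_subst n m (F : form n) (G : 'I_n -> form m) :
  eval (subst F G) = compose (eval F) (fun i => eval (G i)).
Proof.
apply/funext => x; rewrite /compose; case: F => //= [i|t w].
  case: (G i) => //= [j|t w]; rewrite /retract row_cell col_cell ?collapse_col //.
  by congr cell; case: w => //= k j; rewrite collapse_label.
congr cell.
  by case: t => //= i; case: (G i) => //= [j|t' w']; rewrite row_cell.
by case: w => //= k i; case: (G i) => //= [j|t' w']; rewrite label_cell.
Qed.

(** Forced by the identity between [retract (basic k)] and [basic None]. *)
Definition admissible (P : set (option L)) : Prop := forall k, P k -> P None.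

(** Substitution never separates the two variables of a cell unless [basic k] is
    available: if both parts read the same variable, then substituting a
    projection keeps this so, and substituting anything else makes the label
    constant. Only [retract] changes the label, into [label None]. *)
Lemma allowed_subst P n m (F : form n) (G : 'I_n -> form m) : admissible P ->
  allowed P F -> (forall i, allowed P (G i)) -> allowed P (subst F G).
Proof.
move=> adm; case: F => [i|c|i|t w] //= allowedF allowedG.
  case: (G i) (allowedG i) => //= -[]// i' [//|k l]/= [->|/adm]; by [left|right].
case: t allowedF => //= i; case: w => [w|k j] /=.
  by case: (G i) => //= -[].
case=> [<-|Pk].
  by case: (G i) (allowedG i) => //= [l _|[]//]; left.
by case: (G i) (G j) => [?|?|?|[?|?] ?] [?|?|?|? ?] //=; right.
Qed.

Lemma form_clone_is_clone P : admissible P -> is_clone (form_clone P).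
Proof.
move=> adm; split=> [n k|n m f h].
  by exists (FProj k).
move=> /form_cloneP[F [allowedF ->]] formh.
have [G GP] := choice (fun i => (form_cloneP P (h i)).1 (formh i)).
apply/form_cloneP; exists (subst F G); split.
  by apply: allowed_subst => // i; case: (GP i).
rewrite eval_subst; congr compose; apply/funext => i; by case: (GP i).
Qed.

Lemma allowed_unary P (F : form 1) : allowed P F.
Proof. by case: F => //= -[]// i [//|k j]; left; rewrite !ord1. Qed.

Definition unary_forms : set (op X 1) := [set f | exists F : form 1, f = eval F].

(** With a single variable the condition on [P] is void, so all the clones
    [form_clone P] lie in the same monoidal interval. *)
Lemma unary_part_form_clone P : unary_part (form_clone P) = unary_forms.
Proof.
apply/funext => f; apply/propext; split=> [/form_cloneP[F [_ ->]]|[F ->]].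
  by exists F.
by apply/form_cloneP; exists F; split=> //; exact: allowed_unary.
Qed.

Lemma form_clone_mono P Q : P `<=` Q -> form_clone P `<=` form_clone Q.
Proof.
move=> PQ [n f] [F [allowedF fE]]; exists F; split=> // {fE}.
by case: F allowedF => //= -[]// i [//|k j]/= [|/PQ]; [left|right].
Qed.

Lemma unary_forms_submonoid : is_unary_submonoid unary_forms.
Proof.
split=> [|f h [F ->] [H ->]]; first by exists (FProj ord0).
by exists (subst F (fun=> H)); rewrite eval_subst.
Qed.

(** * Operations preserving the monoid *)

(** The outside points are kept as extra rows and columns, so that [ext_row] and
    [ext_col] jointly determine a point. *)
Definition ext_row (x : X) : nat + (option nat + X) :=
  match phi x with inl (t, _) => inl t | inr y => inr y end.

Definition ext_col (x : X) : option nat + (option nat + X) :=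
  match phi x with inl (_, w) => inl w | inr y => inr y end.

Definition outside : X := psi (inr (inl None)).

Lemma ext_row_cell t w : ext_row (cell t w) = inl t.
Proof. by rewrite /ext_row /cell psiK. Qed.

Lemma ext_col_cell t w : ext_col (cell t w) = inl w.
Proof. by rewrite /ext_col /cell psiK. Qed.

Lemma ext_row_col_inj x y : ext_row x = ext_row y -> ext_col x = ext_col y -> x = y.
Proof.
rewrite /ext_row /ext_col => tE wE; apply: (can_inj phiK); move: tE wE.
by case: (phi x) => [[t w]|z]; case: (phi y) => [[t' w']|z'] // [->] // [->].
Qed.

Lemma ext_row_col_cell x t w :
  ext_row x = inl t -> ext_col x = inl w -> x = cell t w.
Proof.
by move=> tx wx; apply: ext_row_col_inj; rewrite ?ext_row_cell ?ext_col_cell.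
Qed.

Lemma ext_row_not_cell x y w : ext_row x = inr y -> ext_col x = inl w -> False.
Proof. by rewrite /ext_row /ext_col; case: (phi x) => [[]|]. Qed.

Lemma ext_col_inr x y : ext_col x = inr y -> x = psi (inr y).
Proof.
rewrite /ext_col => wE; apply: (can_inj phiK); rewrite psiK; move: wE.
by case: (phi x) => [[]|z] // [->].
Qed.

Definition row_maps : set (X -> nat + (option nat + X)) :=
  [set u | u = ext_row \/ u = (fun x => inl (row x))].

Definition col_maps : set (X -> option nat + (option nat + X)) :=
  [set u | [\/ u = ext_col, u = (fun x => inl (col x)) |
               exists k, u = (fun x => inl (label k x))]].

Lemma ext_row_unary (F : form 1) :
  constant_or_in row_maps (fun z => ext_row (eval F (fun=> z))).
Proof.
case: F => [i|c|i|t w] /=.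
- by left; left.
- by right.
- by left; right; apply/funext => z; rewrite ext_row_cell.
- case: t => [t|i]; first by right=> z z'; rewrite !ext_row_cell.
  by left; right; apply/funext => z; rewrite ext_row_cell.
Qed.

Lemma ext_col_unary (F : form 1) :
  constant_or_in col_maps (fun z => ext_col (eval F (fun=> z))).
Proof.
case: F => [i|c|i|t w] /=.
- by left; apply: Or31.
- by right.
- by left; apply: Or32; apply/funext => z; rewrite ext_col_cell.
- case: w => [w|k i]; first by right=> z z'; rewrite !ext_col_cell.
  by left; apply: Or33; exists k; apply/funext => z; rewrite ext_col_cell.
Qed.

Definition unary_sections n (h : op X n) : Prop :=
  forall i x, exists F : form 1, forall z, h (update x i z) = eval F (fun=> z).

Lemma sum_succ_neq (a b c : nat) :
  [/\ (a + b + c).+1 <> a, (a + b + c).+1 <> b & (a + b + c).+1 <> c].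
Proof.
split=> /eqP; rewrite gtn_eqF // ltnS ?leq_addl // addnAC ?leq_addl //.
by rewrite -addnA leq_addr.
Qed.

Lemma rigid_ext_row n (h : op X n) : unary_sections h ->
  (exists c, forall x, ext_row (h x) = c) \/
  (exists i u, row_maps u /\ forall x, ext_row (h x) = u (x i)).
Proof.
move=> sec; pose N (v : nat + (option nat + X)) := if v is inl m then m else 0.
apply: (@rigid _ _ _ N row row row_maps _ _ n (fun x => ext_row (h x)) outside).
- move=> u x [->|->]; left=> //.
  by rewrite /row /ext_row; case: (phi x) => [[]|].
- move=> u uT a b c; exists (cell (a + b + c).+1 None).
  suff -> : N (u (cell (a + b + c).+1 None)) = (a + b + c).+1.
    exact: sum_succ_neq.
  by case: uT => ->; rewrite ?ext_row_cell ?row_cell.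
- move=> i x; have [F FE] := sec i x.
  by under [fun z => _]funext do rewrite FE; exact: ext_row_unary.
Qed.

Lemma rigid_ext_col n (h : op X n) : unary_sections h ->
  (exists c, forall x, ext_col (h x) = c) \/
  (exists i u, col_maps u /\ forall x, ext_col (h x) = u (x i)).
Proof.
move=> sec.
pose N (v : option nat + (option nat + X)) := if v is inl (Some m) then m else 0.
apply: (@rigid _ _ _ N (fun x => odflt 0 (col x))
  (fun x => odflt 0 (label None x)) col_maps _ _ n
  (fun x => ext_col (h x)) outside).
- move=> u x [->|->|[k ->]]; [left|by left|right].
    by rewrite /col /ext_col; case: (phi x) => [[t []]|].
  by rewrite -(collapse_label k x); case: (label k x).
- move=> u uW a b c.
  suff [x xE] : exists x, N (u x) = (a + b + c).+1.
    by exists x; rewrite xE; exact: sum_succ_neq.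
  case: uW => [->|->|[k ->]].
  + by exists (cell 0 (Some (a + b + c).+1)); rewrite ext_col_cell.
  + by exists (cell 0 (Some (a + b + c).+1)); rewrite col_cell.
  + by exists (psi (inr (inl (Some (a + b + c).+1)))); rewrite /label psiK; case: k.
- move=> i x; have [F FE] := sec i x.
  by under [fun z => _]funext do rewrite FE; exact: ext_col_unary.
Qed.

(** Within the monoid only the identity and [retract] read the column of a cell,
    so such a map is known entirely from its column: this is the use of the next
    two lemmas. *)
Lemma unary_form_id (F : form 1) :
  (forall z, ext_col (eval F (fun=> z)) = ext_col z) ->
  forall z, eval F (fun=> z) = z.
Proof.
have outsideE : ext_col outside = inr (inl None) by rewrite /ext_col psiK.
case: F => //= [c|i|t w] E z.
- by have := E (cell 0 None); rewrite (E outside) outsideE ext_col_cell.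
- by have := E outside; rewrite outsideE ext_col_cell.
- by have := E outside; rewrite outsideE ext_col_cell.
Qed.

Lemma unary_form_retract (F : form 1) :
  (forall z, ext_col (eval F (fun=> z)) = inl (col z)) ->
  forall z, eval F (fun=> z) = retract z.
Proof.
have outsideE : ext_col outside = inr (inl None) by rewrite /ext_col psiK.
case: F => //= [i|c|t w] E z.
- by have := E outside; rewrite outsideE.
- by have := E (cell 0 (Some 1)); rewrite (E (cell 0 (Some 0))) !col_cell.
- case: w E => [w|k i] E.
    have := E (cell 0 (Some 1)).
    by have := E (cell 0 (Some 0)); rewrite !ext_col_cell !col_cell => -[->].
  by have := E (cell 0 (Some 1)); rewrite /= ext_col_cell col_cell label_cell.
Qed.

(** Rows and columns are found separately by rigidity. A row and a column read
    from cells through different variables do not occur: a column read from a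
    cell determines the section, which is then the identity or [retract]. *)
Lemma classify n (h : op X n) :
  unary_sections h -> exists F : form n, h = eval F.
Proof.
move=> sec.
have rowE (w : ('I_n -> X) -> option nat) :
    (forall x, ext_col (h x) = inl (w x)) ->
    exists t : row_term n, forall x, h x = cell (row_eval t x) (w x).
  move=> hw; case: (rigid_ext_row sec) => [[[t|y] hc]|[i [u [[->|->] hu]]]].
  - by exists (RowConst t) => x; apply: ext_row_col_cell.
  - by case: (ext_row_not_cell (hc (fun=> outside)) (hw _)).
  - have := hu (fun=> outside); rewrite {2}/ext_row psiK => ht.
    by case: (ext_row_not_cell ht (hw _)).
  - by exists (RowOf i) => x; apply: ext_row_col_cell.
case: (rigid_ext_col sec) => [[[w|y] hc]|[i [u [[->|->|[k ->]] hu]]]].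
- have [t ht] := rowE _ hc.
  by exists (FCell t (ColConst w)); apply/funext.
- by exists (FConst (psi (inr y))); apply/funext => x; apply: ext_col_inr.
- exists (FProj i); apply/funext => x /=; have [F FE] := sec i x.
  rewrite -{1}(update_self x i) FE; apply: unary_form_id => z.
  by rewrite -FE hu /update eqxx.
- exists (FRetract i); apply/funext => x /=; have [F FE] := sec i x.
  rewrite -{1}(update_self x i) FE; apply: unary_form_retract => z.
  by rewrite -FE hu /update eqxx.
- have [t ht] := rowE _ hu.
  by exists (FCell t (LabelOf k i)); apply/funext.
Qed.

(** * Clones with the given unary part *)

Definition basic_form (k : option L) : form 2 :=
  FCell (RowOf ord0) (LabelOf k (lift ord0 ord0)).

Definition basic k : op X 2 := eval (basic_form k).

Section Interval.
Variable C : set (operation X).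
Hypothesis C_clone : is_clone C.
Hypothesis C_unary : unary_part C = unary_forms.

Definition basics : set (option L) := [set k | C (Operation (basic k))].

Let C_proj n (i : 'I_n.+1) : C (Operation (@Defs.proj X n.+1 i)).
Proof. by case: C_clone. Qed.

Let C_comp n m (f : op X n.+1) (h : 'I_n.+1 -> op X m.+1) :
  C (Operation f) -> (forall i, C (Operation (h i))) ->
  C (Operation (compose f h)).
Proof. by case: C_clone => _; apply. Qed.

Let C_form1 (F : form 1) : C (Operation (eval F)).
Proof.
have : unary_part C (eval F) by rewrite C_unary; exists F.
by [].
Qed.

Lemma basics_admissible : admissible basics.
Proof.
move=> k Ck; rewrite /basics /=.
have -> : basic None = compose (eval (FRetract (ord0 : 'I_1))) (fun=> basic k).
  apply/funext => x; rewrite /compose /= /basic /= /retract row_cell col_cell.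
  by rewrite collapse_label.
by apply: C_comp => //; apply: C_form1.
Qed.

(** Substituting constants for all variables but one shows that all sections of
    an operation of [C] lie in the monoid, so [classify] applies; and [C]
    contains [basic k] once it contains a cell form with two different variables,
    by identification of variables. *)
Lemma sub_form_clone : C `<=` form_clone basics.
Proof.
move=> [n f] Cf.
have [F fE] : exists F : form n.+1, f = eval F.
  apply: classify => i x.
  pose h := compose f (fun j => if j == i then Defs.proj ord0
     else eval (FConst (x j) : form 1)).
  have : unary_part C h.
    by apply: C_comp => // j; case: ifP => _; [exact: C_proj|exact: C_form1].
  rewrite C_unary => -[F hE]; exists F.
  move=> z; rewrite -hE /h /compose; congr f; apply/funext => j.
  by rewrite /update; case: ifP.
exists F; split=> //.
case: F fE => //= -[]// i [//|k j] fE /=.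
case: (eqVneq i j) => [|ij]; [by left|right].
rewrite /basics /=.
have -> : basic k = compose f (fun l => if l == i then Defs.proj ord0 else
    Defs.proj (lift ord0 ord0)).
  apply/funext => x; rewrite fE /basic /compose /= eqxx.
  by rewrite eq_sym (negbTE ij).
by apply: C_comp => // l; case: ifP => _; exact: C_proj.
Qed.

Lemma form_clone_sub : form_clone basics `<=` C.
Proof.
move=> [n f] [F [allowedF /= ->]].
have un (H : form 1) (i : 'I_n.+1) : eval F = compose (eval H) (fun=> Defs.proj i) ->
    C (Operation (eval F)).
  by move=> ->; apply: C_comp => // _; exact: C_proj.
case: F allowedF un => [i|c|i|[t|i] [w|k j]] /= allowedF un.
- exact: C_proj.
- exact: (un (FConst c) ord0).
- exact: (un (FRetract ord0) i).
- exact: (un (FCell (RowConst t) (ColConst w)) ord0).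
- exact: (un (FCell (RowConst t) (LabelOf k ord0)) j).
- exact: (un (FCell (RowOf ord0) (ColConst w)) i).
- case: allowedF => [ij|Ck].
    by apply: (un (FCell (RowOf ord0) (LabelOf k ord0)) i); rewrite -ij.
  set f' := eval _.
  have -> : f' = compose (basic k)
      (fun l => if l == ord0 then Defs.proj i else Defs.proj j).
    exact/funext.
  by apply: C_comp => // l; case: ifP => _; exact: C_proj.
Qed.

Lemma clone_eq_form_clone : C = form_clone basics.
Proof. by apply/seteqP; split; [exact: sub_form_clone|exact: form_clone_sub]. Qed.

End Interval.

Lemma label_inj k k' : (forall x, label k x = label k' x) -> k = k'.
Proof.
move=> labelE.
case: k k' labelE => [a|] [b|] labelE //.
- congr Some; apply: S_inj; apply/funext => x; apply/propext.
  have := labelE (psi (inr (inr x))); rewrite /label psiK.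
  by case: asboolP; case: asboolP.
- by have := labelE outside; rewrite /label psiK.
- by have := labelE outside; rewrite /label psiK.
Qed.

(** * The order isomorphism *)

Definition args (x y : X) : 'I_2 -> X := fun i => if i == ord0 then x else y.

(** The operation [basic k] is the value of no other form: its row depends on the
    first variable, its column on the second, and the label is determined. *)
Lemma basics_form_clone P : basics (form_clone P) = P.
Proof.
apply/seteqP; split=> k; last first.
  by move=> Pk; apply/form_cloneP; exists (basic_form k); split=> //; right.
move=> /form_cloneP[F [allowedF kE]].
have {}kE x y : cell (row x) (label k y) = eval F (args x y).
  by rewrite -kE.
have tE x y : row x = row (eval F (args x y)) by rewrite -kE row_cell.
have wE x y : inl (label k y) = ext_col (eval F (args x y)).
  by rewrite -kE ext_col_cell.
have outsideE : ext_col outside = inr (inl None) by rewrite /ext_col psiK.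
have labelS : label k (psi (inr (inl (Some 1)))) = Some 1.
  by rewrite /label psiK; case: (k).
case: F allowedF tE wE {kE} => [i|c|i|[t|i] [w|l j]] /= allowedF tE wE.
- by have := wE outside outside; rewrite /args if_same outsideE.
- by have := tE (cell 0 None) outside; rewrite -(tE (cell 1 None) outside) !row_cell.
- have [i0|i0] := eqVneq i ord0.
    have := wE (cell 0 None) (psi (inr (inl (Some 1)))).
    by rewrite /args i0 eqxx labelS ext_col_cell col_cell.
  have := tE (cell 0 None) outside; have := tE (cell 1 None) outside.
  by rewrite /args (negbTE i0) !row_cell => <-.
- have := tE (cell 0 None) outside; have := tE (cell 1 None) outside.
  by rewrite !row_cell => <-.
- have := tE (cell 0 None) outside; have := tE (cell 1 None) outside.
  by rewrite !row_cell => <-.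
- have := wE outside (psi (inr (inl (Some 1)))).
  have := wE outside (cell 0 None).
  by rewrite !ext_col_cell labelS label_cell => -[<-].
- have i0 : i == ord0.
    apply/negPn/negP => i0.
    have := tE (cell 0 None) outside; have := tE (cell 1 None) outside.
    by rewrite /args (negbTE i0) !row_cell => <-.
  have j0 : j != ord0.
    apply/negP => j0.
    have := wE outside (psi (inr (inl (Some 1)))).
    have := wE outside (cell 0 None).
    by rewrite /args j0 !ext_col_cell labelS label_cell => -[<-].
  have -> : k = l.
    apply: label_inj => x; have := wE outside x.
    by rewrite /args (negbTE j0) ext_col_cell => -[].
  by case: allowedF => // ij; move: j0; rewrite -ij i0.
Qed.

Definition decode (P : set (option L)) : option (set L) :=
  if `[< P None >] then Some [set a | P (Some a)] else None.

Definition encode (A : option (set L)) : set (option L) :=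
  if A is Some A then [set k | if k is Some a then A a else True] else set0.

Lemma encode_admissible A : admissible (encode A).
Proof. by case: A => [A|] //= [a|]. Qed.

Lemma encodeK : cancel encode decode.
Proof.
by case=> [A|]; rewrite /decode /=; case: asboolP.
Qed.

Lemma decode_le P Q : admissible P -> admissible Q ->
  (P `<=` Q <-> le_add_bottom (@subset L) (decode P) (decode Q)).
Proof.
move=> admP admQ; rewrite /decode; case: asboolP => [PN|nPN]; last first.
  by split=> // _ k /admP.
case: asboolP => [QN|nQN] /=; last by split=> // /(_ _ PN).
split=> [PQ a|PQ [a|_]//].
  exact: (PQ (Some a)).
exact: (PQ a).
Qed.

Lemma interval_iso :
  order_isomorphic (monoidal_interval unary_forms) (@subset (operation X))
    [set: option (set L)] (le_add_bottom (@subset L)).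
Proof.
have le C D : monoidal_interval unary_forms C -> monoidal_interval unary_forms D ->
    C `<=` D <-> le_add_bottom (@subset L) (decode (basics C)) (decode (basics D)).
  move=> [Cc Cu] [Dc Du]; rewrite -decode_le; try exact: basics_admissible.
  split=> [CD k|]; first exact: CD.
  by move=> /form_clone_mono; rewrite -!clone_eq_form_clone.
have le_refl A : le_add_bottom (@subset L) A A by case: A => // A a.
exists (fun C => decode (basics C)); split=> //; split=> //.
  move=> C D /set_mem IC /set_mem ID E; apply/seteqP.
  by split; apply/le => //; rewrite E.
move=> A _; exists (form_clone (encode A)); last by rewrite basics_form_clone encodeK.
split; last exact: unary_part_form_clone.
exact/form_clone_is_clone/encode_admissible.
Qed.

End Construction.

(** * Absorbing a countable summand *)

Lemma card_le_injective (T U : Type) :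
  [set: T] #<= [set: U] -> exists f : T -> U, injective f.
Proof.
move=> /card_leP[f].
exists (fun x => val (f (to_setT x))) => x y /val_inj.
by move=> /(@injT _ _ f)/(f_equal val).
Qed.

Lemma injective_card_le (T U : Type) (f : T -> U) :
  injective f -> [set: T] #<= [set: U].
Proof.
move=> f_inj; apply/card_leP/injfunPex.
exists (fun x => to_setT (f (val x))) => // x y _ _ /(f_equal val) /= /f_inj.
exact: val_inj.
Qed.

(** Along a sequence [e] without repetitions, the elements of [X] are moved to odd
    positions, which frees the even ones for [K]. *)
Lemma bijection_countable_sum (X : Type) (K : countType) :
  infinite_set [set: X] ->
  exists phi : X -> K + X, exists psi, cancel phi psi /\ cancel psi phi.
Proof.
move=> /infiniteP/card_le_injective[e e_inj].
have leX : [set: X] #<= [set: K + X].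
  by apply: (@injective_card_le _ _ inr) => x y [].
have geX : [set: K + X] #<= [set: X].
  have [shift [shift_inj shift_new]] : exists shift : X -> X,
      injective shift /\ forall x n, shift x <> e n.*2.
    exists (fun x => if pselect (exists n, e n = x) is left ex
                     then e (projT1 (cid ex)).*2.+1 else x).
    split=> [x y|x n]; case: pselect => [ex|nx].
    - case: pselect => [ey /e_inj[]/double_inj exy|ny]; last first.
        by move=> yE; case: ny; exists (projT1 (cid ex)).*2.+1.
      by move: exy; case: (cid ex) (cid ey) => m em [m' em'] /= mm; rewrite -em mm.
    - case: pselect => // ey xE.
      by case: nx; exists (projT1 (cid ey)).*2.+1.
    - by move=> /e_inj /(f_equal odd) /=; rewrite !odd_double.
    - by move=> xE; apply: nx; exists n.*2.
  apply: (@injective_card_le _ _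
    (fun z => match z with inl k => e (pickle k).*2 | inr x => shift x end)).
  move=> [k|x] [k'|x'] /=.
  - by move=> /e_inj/double_inj/(pcan_inj pickleK) ->.
  - by move=> /esym/shift_new.
  - by move=> /shift_new.
  - by move=> /shift_inj ->.
have /card_eqP[f] := Cantor_Bernstein leX geX.
have [h fK hK] : bijective f by [].
exists (fun x => val (f (to_setT x))), (fun z => val (h (to_setT z))).
split=> x.
  by rewrite (_ : to_setT _ = f (to_setT x)) ?fK //; apply: val_inj.
by rewrite (_ : to_setT _ = h (to_setT x)) ?hK //; apply: val_inj.
Qed.

Unset Implicit Arguments.

Theorem corollary3 (X L : Type)
  (X_infinite : infinite_set [set: X])
  (L_le : [set: L] #<= [set: set X]) :
  exists I : set (set (operation X)),
    is_monoidal_interval I /\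
    order_isomorphic I (@subset (operation X))
      [set: option (set L)] (le_add_bottom (@subset L)).
Proof.
have [S S_inj] := card_le_injective L_le.
have [phi1 [psi1 [phi1K psi1K]]] :=
  bijection_countable_sum (nat * option nat)%type X_infinite.
have [phi2 [psi2 [phi2K psi2K]]] :=
  bijection_countable_sum (option nat) X_infinite.
pose phi x : (nat * option nat) + (option nat + X) :=
  match phi1 x with inl a => inl a | inr y => inr (phi2 y) end.
pose psi z := match z with inl a => psi1 (inl a) | inr y => psi1 (inr (psi2 y)) end.
have phiK : cancel phi psi.
  by move=> x; rewrite -[RHS]phi1K /phi; case: (phi1 x) => //= y; rewrite phi2K.
have psiK : cancel psi phi.
  by case=> [a|y]; rewrite /phi /psi psi1K ?psi2K.
exists (monoidal_interval (unary_forms phi psi S)); split; last exact: interval_iso.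
exists (unary_forms phi psi S); split=> //; exact: unary_forms_submonoid.
Qed.
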